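(* For each of the two quadruples $S\in\{(P_1,P_2,P_4,P_5),\,(P_1,P_3,P_4,P_5)\}$, as formal power series in $x$, $$\sum_{n\ge 0}|\mathcal{M}_n(S)|\,x^n=\frac{1-4x+6x^2-3x^3-x^4}{(1-x)^3(1-2x)}.$$
   Context: A matching with $n$ arcs is a partition of $\{1,2,\ldots,2n\}$ into blocks of size 2, called arcs; an arc is written $[a,b]$ with $a<b$, where $a$ is its opener and $b$ its closer. For $n=0$ there is exactly one (empty) matching. A matching is Stoimenow if it contains no pair of arcs $[i,\ell],[i+1,k]$ with $i+1<k<\ell$ (Type 1) and no pair of arcs $[k,j+1],[\ell,j]$ with $k<\ell<j$ (Type 2). A matching $M$ contains a pattern (a matching) $P$ with $m$ arcs if some $m$ arcs of $M$ become $P$ after their $2m$ endpoints are relabelled $1,\ldots,2m$ in the order-preserving way; otherwise $M$ avoids $P$. $\mathcal{M}_n(S)$ denotes the set of Stoimenow matchings with $n$ arcs avoiding every pattern in $S$. The patterns are $P_1=\{[1,3],[2,7],[4,5],[6,8]\}$, $P_2=\{[1,3],[2,5],[4,7],[6,8]\}$, $P_3=\{[1,2],[3,5],[4,6],[7,8]\}$, $P_4=\{[1,2],[3,5],[4,7],[6,8]\}$, $P_5=\{[1,3],[2,5],[4,6],[7,8]\}$. *)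

(* Defs.v *)
From mathcomp Require Import all_boot all_order all_algebra.

Set Implicit Arguments.
Unset Strict Implicit.
Unset Printing Implicit Defensive.

Import GRing.Theory.

(* The point p of {1, ..., 2n} is encoded as the ordinal of value p - 1; all
   the notions below depend only on the order and the successor relation. *)
Definition blocks (n : nat) := {set {set 'I_(2 * n)}}.

Definition is_matching (n : nat) (M : blocks n) : bool :=
  partition M [set: 'I_(2 * n)] && [forall B in M, #|B| == 2].

Definition arc (n : nat) (M : blocks n) (a b : 'I_(2 * n)) : bool :=
  (a < b) && ([set a; b] \in M).

Definition type1 (n : nat) (M : blocks n) : bool :=
  [exists i : 'I_(2 * n), exists j : 'I_(2 * n),
    exists k : 'I_(2 * n), exists l : 'I_(2 * n),
    [&& j == i.+1 :> nat, arc M i l, arc M j k & k < l]].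

Definition type2 (n : nat) (M : blocks n) : bool :=
  [exists k : 'I_(2 * n), exists l : 'I_(2 * n),
    exists j : 'I_(2 * n), exists j' : 'I_(2 * n),
    [&& j' == j.+1 :> nat, arc M k j', arc M l j & k < l]].

Definition stoimenow (n : nat) (M : blocks n) : bool :=
  ~~ type1 M && ~~ type2 M.

(* g is the inverse of the order-preserving relabelling of the endpoints of
   the arcs in A. *)
Definition contains (n m : nat) (M : blocks n) (P : blocks m) : bool :=
  [exists A : blocks n,
    [&& A \subset M, #|A| == m
      & [exists g : {ffun 'I_(2 * m) -> 'I_(2 * n)},
          [forall x : 'I_(2 * m), forall y : 'I_(2 * m),
              (x < y) ==> (g x < g y)]
          && (A == [set g @: B | B : {set 'I_(2 * m)} in P])]]].

Definition stoimenow_avoiding (m n : nat) (S : seq (blocks m)) :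
    {set blocks n} :=
  [set M : blocks n |
    [&& is_matching M, stoimenow M & all (fun P => ~~ contains M P) S]].

(* a and b are 1-based here, so that the patterns read as usual. *)
Definition arc8 (a b : nat) : {set 'I_(2 * 4)} :=
  [set (inord a.-1 : 'I_8); (inord b.-1 : 'I_8)].

Definition P1 : blocks 4 := [set arc8 1 3; arc8 2 7; arc8 4 5; arc8 6 8].
Definition P2 : blocks 4 := [set arc8 1 3; arc8 2 5; arc8 4 7; arc8 6 8].
Definition P3 : blocks 4 := [set arc8 1 2; arc8 3 5; arc8 4 6; arc8 7 8].
Definition P4 : blocks 4 := [set arc8 1 2; arc8 3 5; arc8 4 7; arc8 6 8].
Definition P5 : blocks 4 := [set arc8 1 3; arc8 2 5; arc8 4 6; arc8 7 8].

Local Open Scope ring_scope.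

(* A formal power series is its sequence of coefficients; two series are equal
   when they agree coefficientwise, i.e. for =1. *)
Definition fps (R : Type) := nat -> R.

Definition fps_poly (R : nzRingType) (p : {poly R}) : fps R := fun n => p`_n.

Definition fps_mul (R : nzRingType) (f g : fps R) : fps R :=
  fun n => \sum_(i < n.+1) f i * g (n - i)%N.

(* The first n coefficients of 1 / f, each obtained from the previous ones by
   solving the corresponding coefficient of f * (1 / f) = 1. *)
Fixpoint fps_inv_coefs (R : comUnitRingType) (f : fps R) (n : nat) : seq R :=
  if n is n'.+1 then
    let s := fps_inv_coefs f n' in
    rcons s (((n' == 0%N)%:R - \sum_(i < n') f i.+1 * s`_(n' - i.+1)) / f 0%N)
  else [::].

Definition fps_inv (R : comUnitRingType) (f : fps R) : fps R :=
  fun n => (fps_inv_coefs f n.+1)`_n.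

Definition fps_div (R : comUnitRingType) (f g : fps R) : fps R :=
  fps_mul f (fps_inv g).

Lemma size_fps_inv_coefs (R : comUnitRingType) (f : fps R) (n : nat) :
  size (fps_inv_coefs f n) = n.
Proof. by elim: n => //= n IHn; rewrite size_rcons IHn. Qed.

Lemma nth_fps_inv_coefs (R : comUnitRingType) (f : fps R) (n k : nat) :
  (k < n)%N -> (fps_inv_coefs f n)`_k = fps_inv f k.
Proof.
elim: n => // n IHn; rewrite ltnS leq_eqVlt => /orP[/eqP-> // | ltkn].
by rewrite /= nth_rcons size_fps_inv_coefs ltkn IHn.
Qed.

Lemma fps_mulV (R : comUnitRingType) (f : fps R) :
  f 0%N \is a GRing.unit -> fps_mul f (fps_inv f) =1 fps_poly 1.
Proof.
move=> f0U n; rewrite /fps_mul /fps_poly big_ord_recl subn0 coef1.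
rewrite {1}/fps_inv /= nth_rcons size_fps_inv_coefs ltnn eqxx.
rewrite [f _ * (_ / _)]mulrC divrK //.
rewrite [X in _ - X](_ : _ = \sum_(i < n) f i.+1 * fps_inv f (n - i.+1)%N).
  by rewrite subrK.
apply: eq_bigr => i _; rewrite nth_fps_inv_coefs //.
by rewrite ltn_subrL /= (leq_ltn_trans _ (ltn_ord i)).
Qed.

(* Main.v *)
Require Import Defs.
From mathcomp Require Import all_boot all_order all_algebra zify ring.

Set Implicit Arguments.
Unset Strict Implicit.
Unset Printing Implicit Defensive.

(** The number of matchings is 1 for n = 0 and 2^(n-1) + C(n-1,2) for n >= 1,
    for both quadruples; the rational function is the generating function of
    that sequence. The count goes as follows.

    A Stoimenow matching that avoids P1 has no nested pair of arcs at all.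
    Indeed, if [x,px] encloses [y,py], the Stoimenow conditions put a closer e
    between x and y whose arc starts before x, and an opener f between py and
    px whose arc ends after px; these four arcs form P1
    ([closer_between_openers], [opener_between_closers], [partner_mono]).
    Conversely P1 and both forbidden types contain a nesting. In a nonnesting
    matching the i-th opener is joined to the i-th closer, so the matching
    amounts to the word of openers and closers, that is, to the function h
    sending i to the number of openers preceding the i-th closer (indices
    starting at 0). These h are the staircases: nondecreasing with
    i < h i <= n ([stoimenow_avoiding_P1], [matching_of_inj]). The arcs i < j
    cross iff j < h i and follow one another iff h i <= j, so containment of
    P2, ..., P5 becomes a condition on four indices
    ([contains_P2], ..., [contains_P5]).

    Read as interval orders (an arc is below the arcs that lie to its right),
    staircases are semiorders, and the two classes are as follows.
    - Avoiding P2, P4, P5 ([avoid_P245]): either h is a weak order, an ordinal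
      sum of antichains, or it is the disjoint union of an antichain and a
      complete bipartite order, in which case h takes a value s < n on [0,p)
      and the value n on [p,n), with 0 < p < s < n.
    - Avoiding P3, P4, P5 ([avoid_P345]): either the order has no chain of
      three elements, or it is an antichain, then a nonempty chain, then an
      antichain, each above the previous one.
    In both cases the first family is in bijection with the subsets of a set
    of n-1 elements and the second one with the pairs of such elements. A weak
    order is given by the places where it is cut ([next_cut]). A staircase
    without three-element chains is the word O^K v O C^(n-K), where v is an
    arbitrary word of length n-1 having K closers, and it is given by the set
    of the closers of v ([shifted_vals]). *)

(** * Staircases that avoid the patterns *)

(** Only the values below [n] matter. *)
Definition staircase n (h : nat -> nat) : Prop :=
  (forall i, i < n -> i < h i <= n) /\
  (forall i j, i <= j -> j < n -> h i <= h j).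

Definition eq_upto n (h h' : nat -> nat) : Prop :=
  forall i, i < n -> h i = h' i.

(** The four indices stand for four arcs in the order of their openers; the
    conditions below list the comparisons between an opener and a closer that
    imply all the others when [h] is a staircase. *)
Definition four_chain n (R : nat -> nat -> nat -> nat -> Prop) : Prop :=
  exists a b c d, [/\ a < b, b < c, c < d & d < n] /\ R a b c d.

Definition hasP2 n (h : nat -> nat) : Prop :=
  four_chain n (fun a b c d => [/\ b < h a <= c, c < h b <= d & d < h c]).

Definition hasP3 n (h : nat -> nat) : Prop :=
  four_chain n (fun a b c d => [/\ h a <= b, c < h b & h c <= d]).

Definition hasP4 n (h : nat -> nat) : Prop :=
  four_chain n (fun a b c d => [/\ h a <= b, c < h b <= d & d < h c]).

Definition hasP5 n (h : nat -> nat) : Prop :=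
  four_chain n (fun a b c d => [/\ b < h a <= c, c < h b & h c <= d]).

(** Weak orders: arcs that cross a common arc from its right have the same
    arcs above them as that arc. *)
Definition weak n (h : nat -> nat) : Prop :=
  forall i j, i < j -> j < h i -> j < n -> h j = h i.

(** The order consisting of a complete bipartite order with [p] minimal and
    [n - s] maximal elements, and of [s - p] isolated elements. *)
Definition two_step n p s : nat -> nat := fun i => if i < p then s else n.

(** No chain of three elements: whatever lies above the first arc is maximal. *)
Definition flat n (h : nat -> nat) : Prop :=
  forall i, h 0 <= i -> i < n -> h i = n.

(** [p] minimal elements, above them a chain of [q - p] elements, and above it
    [n - q] maximal elements. *)
Definition chain_step n p q : nat -> nat :=
  fun i => if i < p then p else if i < q then i.+1 else n.

(** If [h] is not weak, some crossing arcs [i < j] satisfy [h i < h j], so that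
    the arc [h i] is above [i] but not above [j]. Then nothing is below [i]
    (P4), [h i] is maximal (P5), and P2 forces the value [h i] at [0] and the
    value [n] at [j]; hence [h] has only these two values. *)
Lemma avoid_P245 n h : staircase n h ->
  (~ hasP2 n h /\ ~ hasP4 n h /\ ~ hasP5 n h) <->
  (weak n h \/ exists p s, [/\ 0 < p, p < s, s < n & eq_upto n h (two_step n p s)]).
Proof.
move=> [hlt hmono]; split; last first.
  case=> [wk|[p [s [p0 ps sn E]]]].
    split; [|split].
    - move=> [a [b [c [d [[ab bc cd dn] [/andP[bha hac] /andP[chb hbd] dhc]]]]]].
      have := wk _ _ ab bha; lia.
    - move=> [a [b [c [d [[ab bc cd dn] [hab /andP[chb hbd] dhc]]]]]].
      have := wk _ _ bc chb; lia.
    - move=> [a [b [c [d [[ab bc cd dn] [/andP[bha hac] chb hcd]]]]]].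
      have := wk _ _ ab bha; lia.
  rewrite /eq_upto /two_step in E.
  split; [|split].
  - move=> [a [b [c [d [[ab bc cd dn] [/andP[bha hac] /andP[chb hbd] dhc]]]]]].
    have := E a; have := E b; have := E c; case: ifP; case: ifP; case: ifP; lia.
  - move=> [a [b [c [d [[ab bc cd dn] [hab /andP[chb hbd] dhc]]]]]].
    have := hlt a; have := E a; have := E b; have := E c; case: ifP; case: ifP; case: ifP; lia.
  - move=> [a [b [c [d [[ab bc cd dn] [/andP[bha hac] chb hcd]]]]]].
    have := E a; have := E b; have := E c; case: ifP; case: ifP; case: ifP; lia.
move=> [noP2 [noP4 noP5]].
case: (boolP [exists i : 'I_n, exists j : 'I_n, [&& i < j, j < h i & h i < h j]]); last first.
  move=> /existsPn nex; left=> i j ij jh jn.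
  have il : i < n by lia.
  have := nex (Ordinal il) => /existsPn /(_ (Ordinal jn)) /=.
  by have := hmono i j (ltnW ij) jn; lia.
move=> /existsP[i0 /existsP[j0 /and3P[]]].
move: (ltn_ord j0) => jn; move: (nat_of_ord i0) (nat_of_ord j0) jn => i j jn ij jh hij.
right; have := hlt j jn => jb.
have h0i : i < h 0.
  rewrite ltnNge; apply/negP => le; apply: noP4.
  by exists 0, i, j, (h i); have := hlt 0; split; split; lia.
have m0i : h 0 <= h i by apply: hmono; lia.
have hhi c : h i <= c -> c < n -> h c = n.
  move=> hc cn; have := hlt c cn => cb.
  case: (ltngtP (h c) n) => [lt|gt|//]; last by lia.
  exfalso; apply: noP5; exists i, j, (h i), n.-1.
  have := hmono _ _ hc cn; have := hmono j (h i); have := hlt (h i); split; split; lia.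
have h0E : h 0 = h i.
  apply/eqP; rewrite eqn_leq m0i /= leqNgt; apply/negP => lt.
  (* The arc [maxn (h 0) j] is above [0] and crosses both [i] and [h i]. *)
  apply: noP2; exists 0, i, (maxn (h 0) j), (h i).
  have ipos : 0 < i by move: lt; rewrite lt0n; apply: contraTneq => ->; rewrite ltnn.
  have := hmono j (maxn (h 0) j) (leq_maxr _ _) => hm.
  split; split; lia.
set s := h i in jh hij hhi h0E m0i *.
have big_n j' : i < j' -> j' < s -> s < h j' -> h j' = n.
  move=> ij' js sj; have jn' : j' < n by lia.
  have := hlt j' jn' => jb'.
  case: (ltngtP (h j') n) => [lt|gt|//]; last by lia.
  exfalso; apply: noP2; exists i, j', s, (h j').
  have := hhi s; have := hlt j' jn'; rewrite -/s; split; split; lia.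
have exp : exists p, (p < n) && (s < h p) by exists j; lia.
(* The step is at the first index where [h] exceeds [s]. *)
exists (ex_minn exp), s; case: ex_minnP => p /andP[pn sp] pmin.
have ip : i < p.
  rewrite ltnNge; apply/negP => le; have := hmono p i le; rewrite -/s; lia.
have pj : p <= j by apply: pmin; lia.
split; [lia|lia|lia|] => k kn; rewrite /two_step; case: ifP => kp.
  have := pmin k; rewrite kn /= => kk; have := hmono 0 k; rewrite h0E; lia.
have := hmono p k; have := big_n p; have := hlt k kn; lia.
Qed.

(** Let [p = h 0]. If the arc [b >= p], hence above the arc [0], is not maximal,
    then [b] does not cross [b.+1]: with an arc above [b.+1] this would give P3,
    and with none it would give P4. So the middle part is a chain; it starts at
    [p], and P5 excludes that an arc before [p] crosses [p]. *)
Lemma avoid_P345 n h : staircase n h ->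
  (~ hasP3 n h /\ ~ hasP4 n h /\ ~ hasP5 n h) <->
  (flat n h \/ exists p q, [/\ 0 < p, p < q, q < n & eq_upto n h (chain_step n p q)]).
Proof.
move=> [hlt hmono]; split; last first.
  case=> [fl|[p [q [p0 pq qn E]]]].
    rewrite /flat in fl; split; [|split].
    - move=> [a [b [c [d [[ab bc cd dn] [hab chb hcd]]]]]].
      have := hlt c; have := hmono 0 a; have := hlt a; have := fl b; have := fl c; lia.
    - move=> [a [b [c [d [[ab bc cd dn] [hab /andP[chb hbd] dhc]]]]]].
      have := hmono 0 a; have := hlt a; have := fl b; lia.
    - move=> [a [b [c [d [[ab bc cd dn] [/andP[bha hac] chb hcd]]]]]].
      have := hlt c; have := hmono 0 a; have := hlt a; have := fl c; lia.
  rewrite /eq_upto /chain_step in E.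
  split; [|split].
  - move=> [a [b [c [d [[ab bc cd dn] [hab chb hcd]]]]]].
    have := hlt c; have := hlt a; have := E a; have := E b; have := E c.
    do !case: ifP; lia.
  - move=> [a [b [c [d [[ab bc cd dn] [hab /andP[chb hbd] dhc]]]]]].
    have := hlt a; have := E a; have := E b; have := E c.
    do !case: ifP; lia.
  - move=> [a [b [c [d [[ab bc cd dn] [/andP[bha hac] chb hcd]]]]]].
    have := hlt c; have := E a; have := E b; have := E c.
    do !case: ifP; lia.
move=> [noP3 [noP4 noP5]].
case: (boolP [exists i : 'I_n, (h 0 <= i) && (h i < n)]); last first.
  move=> /existsPn nex; left=> i hi il.
  have := nex (Ordinal il) => /=; have := hlt i il; lia.
move=> /existsP[i0 /andP[]].
move: (ltn_ord i0); move: (nat_of_ord i0) => i il h0i hin; right.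
have := hlt i il => ib.
set p := h 0 in h0i.
have p0 : 0 < p by have := hlt 0; rewrite -/p; lia.
have step b : p <= b -> b < n -> h b < n -> h b = b.+1.
  move=> pb bn hbn; have := hlt b bn => bb.
  case: (ltngtP (h b) b.+1) => [lt|gt|//]; first by lia.
  exfalso; have := hlt b.+1; have := hmono b b.+1.
  case: (ltnP (h b.+1) n) => [lt|ge].
    by move=> ? ?; apply: noP3; exists 0, b, b.+1, n.-1; split; split; lia.
  by move=> ? ?; apply: noP4; exists 0, b, b.+1, (h b); split; split; lia.
have hp : h p = p.+1 by apply: step => //; have := hmono p i; lia.
have low b : b < p -> h b = p.
  move=> bp; have := hmono 0 b; have := hmono b p; rewrite -/p hp => m1 m2.
  case: (ltngtP (h b) p) => [lt|gt|//]; first by lia.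
  exfalso; apply: noP5; exists 0, b, p, p.+1; rewrite hp -/p.
  have b0 : 0 < b by move: gt; rewrite lt0n; apply: contraTneq => ->; rewrite -/p ltnn.
  by have := hmono p i; split; split; lia.
have exq : exists q, (q < n) && (n <= h q).
  by exists n.-1; have := hlt n.-1; lia.
(* The maximal elements begin at the first index where [h] reaches [n]. *)
exists p, (ex_minn exq); case: ex_minnP => q /andP[qn nq] qmin.
have iq : i < q.
  rewrite ltnNge; apply/negP => le; have := hmono q i le; lia.
split; [lia|lia|lia|] => k kn; rewrite /chain_step; case: ifP => kp.
  exact: low.
case: ifP => kq.
  by apply: step; rewrite ?kn //; have := qmin k; lia.
have := hmono q k; have := hlt k kn; lia.
Qed.

(** * Subsets and pairs as parameters *)

Lemma weak_congr n h h' : eq_upto n h h' -> weak n h' -> weak n h.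
Proof.
move=> E wk i j ij jh jn; have il := ltn_trans ij jn.
by rewrite !E //; apply: wk; rewrite -?E.
Qed.

Lemma flat_congr n h h' : eq_upto n h h' -> flat n h' -> flat n h.
Proof.
move=> E fl i hi il; rewrite E //; apply: fl => //.
by rewrite -E //; apply: leq_ltn_trans il.
Qed.

Section NextCut.

Variable k : nat.
Implicit Type A : {set 'I_k}.

(** An element [a] of [A] is a cut between the indices [a] and [a.+1]; every
    index beyond [k] counts as a cut, so that the next cut always exists and
    is at most [k.+1] for the indices up to [k]. *)
Definition is_cut A (i j : nat) : bool :=
  (i < j) && ((k < j) || [exists a in A, a.+1 == j]).

Lemma has_cut A i : exists j, is_cut A i j.
Proof. by exists (maxn i k).+1; rewrite /is_cut !ltnS leq_maxl leq_maxr. Qed.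

Definition next_cut A (i : nat) : nat := ex_minn (has_cut A i).

Lemma next_cutP A i : is_cut A i (next_cut A i).
Proof. by rewrite /next_cut; case: ex_minnP. Qed.

Lemma next_cut_min A i j : is_cut A i j -> next_cut A i <= j.
Proof. by rewrite /next_cut; case: ex_minnP => m _; apply. Qed.

Lemma next_cut_gt A i : i < next_cut A i.
Proof. by case/andP: (next_cutP A i). Qed.

Lemma next_cut_ge A i j : i <= j -> next_cut A i <= next_cut A j.
Proof.
move=> ij; apply: next_cut_min; case/andP: (next_cutP A j) => lt e.
by rewrite /is_cut e andbT (leq_ltn_trans ij lt).
Qed.

Lemma staircase_next_cut A : staircase k.+1 (next_cut A).
Proof.
split=> [i il|i j ij _]; last exact: next_cut_ge.
by rewrite next_cut_gt next_cut_min // /is_cut il ltnSn.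
Qed.

Lemma weak_next_cut A : weak k.+1 (next_cut A).
Proof.
move=> i j ij jh _; apply/eqP; rewrite eqn_leq (next_cut_ge _ (ltnW ij)) andbT.
by apply: next_cut_min; case/andP: (next_cutP A i) => _ e; rewrite /is_cut e jh.
Qed.

(** A cut is recovered as an arc [a] that crosses no later arc. *)
Lemma mem_next_cut A (a : 'I_k) : (a \in A) = (next_cut A a == a.+1).
Proof.
apply/idP/eqP => [aA|E].
  apply/eqP; rewrite eqn_leq next_cut_gt andbT; apply: next_cut_min.
  by rewrite /is_cut ltnSn; apply/orP; right; apply/existsP; exists a; rewrite aA /=.
have /andP[_] := next_cutP A a; rewrite E ltnNge ltn_ord /=.
by case/existsP=> b /andP[bA /eqP[/val_inj<-]].
Qed.

Lemma next_cut_inj A B : eq_upto k.+1 (next_cut A) (next_cut B) -> A = B.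
Proof. by move=> E; apply/setP=> a; rewrite !mem_next_cut E // ltnW // ltnS. Qed.

(** The cuts are the indices [a] with [h a = a.+1]: a weak order is constant on
    the indices from [i] to [(h i).-1], so this last index is the first cut not
    before [i]. *)
Lemma weak_eq_next_cut h : staircase k.+1 h -> weak k.+1 h ->
  exists A, eq_upto k.+1 h (next_cut A).
Proof.
move=> [hlt hmono] wk; exists [set a : 'I_k | h a == a.+1] => i il.
have hi := hlt i il; apply/eqP; rewrite eqn_leq andbC next_cut_min /=; last first.
  rewrite /is_cut; case/andP: hi => -> hi /=; case: ltnP => //= le.
  have lt : (h i).-1 < k by have := hlt i il; lia.
  apply/existsP; exists (Ordinal lt); rewrite inE /= prednK; last by have := hlt i il; lia.
  rewrite eqxx andbT; case: (ltnP i (h i).-1) => ii.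
    by rewrite (wk i (h i).-1); lia.
  by have -> : (h i).-1 = i by have := hlt i il; lia.
have /andP[lt] := next_cutP [set a : 'I_k | h a == a.+1] i.
case/orP=> [kn|/existsP[a]]; first by apply: leq_trans kn; case/andP: hi.
rewrite inE => /andP[/eqP ha /eqP E]; rewrite -E -ha; apply: hmono.
  by rewrite -ltnS E.
by rewrite ltnS ltnW.
Qed.

End NextCut.

Section SortedVals.

Variable k : nat.
Implicit Type A : {set 'I_k}.

Definition vals A : seq nat := [seq val x | x <- enum A].

Lemma vals_sorted A : sorted ltn (vals A).
Proof.
rewrite sorted_map; apply: sorted_filter; first by move=> ? ? ?; apply: ltn_trans.
by have := iota_ltn_sorted 0 k; rewrite -val_enum_ord sorted_map enumT.
Qed.

Lemma size_vals A : size (vals A) = #|A|.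
Proof. by rewrite size_map -cardE. Qed.

Lemma mem_vals A (a : 'I_k) : (val a \in vals A) = (a \in A).
Proof. by rewrite mem_map ?mem_enum //; apply: val_inj. Qed.

Lemma vals_inj : injective vals.
Proof. by move=> A B E; apply/setP=> a; rewrite -!mem_vals E. Qed.

Lemma vals_gap A i j : i <= j -> j < #|A| ->
  nth 0 (vals A) i + (j - i) <= nth 0 (vals A) j.
Proof.
elim: j => [|j IHj]; first by rewrite leqn0 => /eqP ->; rewrite addn0.
rewrite leq_eqVlt => /orP[/eqP -> _|]; first by rewrite subnn addn0.
rewrite ltnS => ij jA.
have := sorted_ltn_nth ltn_trans 0 (vals_sorted A) j j.+1.
rewrite !inE !size_vals (ltnW jA) jA => /(_ isT isT (ltnSn _)) /=.
by have := IHj ij (ltnW jA); lia.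
Qed.

Lemma vals_lt A i : i < #|A| -> nth 0 (vals A) i < k.
Proof.
rewrite -size_vals => /(mem_nth 0) /mapP[x _ ->]; exact: ltn_ord.
Qed.

(** In the word O^K v O C^(k.+1-K), with K the size of [A] and [A] the set of
    positions of the closers in v, the i-th closer is at position
    K + (i-th element of [A]) for i < K, and [i] closers precede it. *)
Definition shifted_vals A (i : nat) : nat :=
  if i < #|A| then #|A| + nth 0 (vals A) i - i else k.+1.

Lemma shifted_vals_bounds A i : i < #|A| -> #|A| <= shifted_vals A i <= k.
Proof.
move=> iA; rewrite /shifted_vals iA.
have := @vals_gap A 0 i (leq0n _) iA.
have := @vals_gap A i #|A|.-1.
have := @vals_lt A #|A|.-1.
by lia.
Qed.

Lemma staircase_shifted_vals A : staircase k.+1 (shifted_vals A).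
Proof.
split=> [i il|i j ij jn].
  case: (ltnP i #|A|) => iA; first by have := shifted_vals_bounds iA; lia.
  by rewrite /shifted_vals (ltnNge i #|A|) iA /= il leqnn.
case: (ltnP j #|A|) => jA.
  rewrite /shifted_vals jA (leq_ltn_trans ij jA).
  by have := vals_gap ij jA; lia.
rewrite {2}/shifted_vals (ltnNge j #|A|) jA /=.
case: (ltnP i #|A|) => iA; first by have := shifted_vals_bounds iA; lia.
by rewrite /shifted_vals (ltnNge i #|A|) iA.
Qed.

Lemma flat_shifted_vals A : flat k.+1 (shifted_vals A).
Proof.
move=> i hi il; rewrite {1}/shifted_vals ifF //; apply/negbTE; rewrite -leqNgt.
case: (posnP #|A|) => [-> //|A0].
by have := shifted_vals_bounds A0; lia.
Qed.

Lemma shifted_vals_inj A B :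
  eq_upto k.+1 (shifted_vals A) (shifted_vals B) -> A = B.
Proof.
move=> E.
have cardle C D : eq_upto k.+1 (shifted_vals C) (shifted_vals D) -> #|C| <= #|D|.
  move=> ECD; rewrite leqNgt; apply/negP => lt.
  have Ck : #|C| <= k by have := max_card (mem C); rewrite card_ord.
  have := ECD #|D|; rewrite {2}/shifted_vals ltnn.
  by have := shifted_vals_bounds lt; lia.
have cE : #|A| = #|B|.
  apply/eqP; rewrite eqn_leq cardle // cardle // => i il; exact/esym/E.
apply: vals_inj; apply: (@eq_from_nth _ 0); rewrite !size_vals // => i iA.
have Ak : #|A| <= k by have := max_card (mem A); rewrite card_ord.
have := E i; rewrite /shifted_vals -cE iA.
have := @vals_gap A 0 i (leq0n _) iA.
have := @vals_gap B 0 i (leq0n _); rewrite -cE => /(_ iA).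
by lia.
Qed.

(** Here K is the number of arcs that are not maximal. Flatness says that
    K <= h 0, that is, the word begins with K openers; what follows them, up to
    the last opener, is the word v. *)
Lemma flat_eq_shifted_vals h : staircase k.+1 h -> flat k.+1 h ->
  exists A, eq_upto k.+1 h (shifted_vals A).
Proof.
move=> [hlt hmono] fl.
have exK : exists K, k < h K by exists k; have := hlt k; lia.
pose K := ex_minn exK; have [hK Kmin] : k < h K /\ forall i, i < K -> h i <= k.
  rewrite /K; case: ex_minnP => m hm mmin; split=> // i im.
  by rewrite leqNgt; apply: contraTN im => /mmin; rewrite -leqNgt.
have Kk : K <= k.
  by rewrite /K; case: ex_minnP => m _; apply; have := hlt k; lia.
have h0 : 0 < K -> K <= h 0.
  move=> K0; rewrite leqNgt; apply/negP => lt.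
  by have := fl (h 0); have := Kmin _ lt; lia.
pose s := [seq h i + i - K | i <- iota 0 K].
pose A := [set a : 'I_k | val a \in s].
have ss : sorted ltn s.
  rewrite sorted_map; apply: (@sub_in_sorted _ [pred i | i < K] ltn).
  - move=> i j; rewrite !inE /= => iK jK ij.
    have := hmono i j; have := hmono 0 i; lia.
  - by apply/allP => i; rewrite mem_iota.
  - exact: iota_ltn_sorted.
have vA : vals A = s.
  apply: (irr_sorted_eq ltn_trans ltnn (vals_sorted A) ss) => x.
  apply/idP/idP => [/mapP[y] |xs]; first by rewrite mem_enum inE => ys ->.
  have xk : x < k.
    case/mapP: xs => i; rewrite mem_iota /= add0n => iK ->.
    have := Kmin i iK; have := hmono 0 i; lia.
  by rewrite -[x]/(val (Ordinal xk)) mem_vals inE.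
have cA : #|A| = K by rewrite -size_vals vA size_map size_iota.
exists A => i il; rewrite /shifted_vals cA vA; case: ifP => iK.
  rewrite (nth_map 0) ?size_iota // nth_iota // add0n.
  have := hmono 0 i; lia.
have := hmono K i; have := hlt i il; lia.
Qed.

End SortedVals.

Lemma staircase_two_step n p s : 0 < p -> p < s -> s < n ->
  staircase n (two_step n p s).
Proof.
move=> p0 ps sn; split=> [i il|i j ij jn]; rewrite /two_step.
  by case: ifP; lia.
by do !case: ifP; lia.
Qed.

Lemma two_step_inj n p s p' s' :
  0 < p -> p < s -> s < n -> 0 < p' -> p' < s' -> s' < n ->
  eq_upto n (two_step n p s) (two_step n p' s') -> (p, s) = (p', s').
Proof.
move=> p0 ps sn p0' ps' sn' E.
have := E 0; have := E p; have := E p'; rewrite /two_step p0 p0' !ltnn.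
by do !case: ifP; move=> *; congr pair; lia.
Qed.

Lemma two_step_not_weak n p s h : 0 < p -> p < s -> s < n ->
  eq_upto n h (two_step n p s) -> ~ weak n h.
Proof.
move=> p0 ps sn E /(_ 0 p); have := E 0; have := E p; rewrite /two_step ltnn p0.
lia.
Qed.

Lemma staircase_chain_step n p q : 0 < p -> p < q -> q < n ->
  staircase n (chain_step n p q).
Proof.
move=> p0 pq qn; split=> [i il|i j ij jn]; rewrite /chain_step.
  by do !case: ifP; lia.
by do !case: ifP; lia.
Qed.

Lemma chain_step_inj n p q p' q' :
  0 < p -> p < q -> q < n -> 0 < p' -> p' < q' -> q' < n ->
  eq_upto n (chain_step n p q) (chain_step n p' q') -> (p, q) = (p', q').
Proof.
move=> p0 pq qn p0' pq' qn' E.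
have := E 0; have := E q; have := E q'; rewrite /chain_step p0 p0' !ltnn.
by do !case: ifP; move=> *; congr pair; lia.
Qed.

Lemma chain_step_not_flat n p q h : 0 < p -> p < q -> q < n ->
  eq_upto n h (chain_step n p q) -> ~ flat n h.
Proof.
move=> p0 pq qn E /(_ p); have := E 0; have := E p; rewrite /chain_step ltnn p0 pq.
lia.
Qed.

Lemma card_ord_lt n m : m <= n -> #|[set j : 'I_n | j < m]| = m.
Proof.
move=> mn; rewrite -[RHS]card_ord.
have winj : injective (widen_ord mn) by move=> x y /(congr1 val) /= /val_inj.
rewrite -(card_imset _ winj); apply: eq_card => j; rewrite inE.
apply/idP/imsetP => [jm|[x _ ->]]; last exact: (ltn_ord x).
by exists (Ordinal jm) => //; apply: val_inj.
Qed.

Lemma card_ltn_pairs k : #|[set x : 'I_k * 'I_k | x.1 < x.2]| = 'C(k, 2).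
Proof.
rewrite -bin2_sum big_mkord -sum1dep_card.
have -> : \sum_(x : 'I_k * 'I_k | x.1 < x.2) 1 = \sum_(i < k) \sum_(j < k | i < j) 1.
  by rewrite pair_big_dep.
rewrite (exchange_big_dep predT) //=; apply: eq_bigr => j _.
by rewrite sum1dep_card card_ord_lt // ltnW.
Qed.

(** * The nonnesting matching of a staircase *)

(** A downward closed set of indices is an initial segment, so belonging to it
    is a comparison with its cardinal. *)
Lemma initial_segment_card n (P : pred 'I_n) (i : 'I_n) :
  (forall j k : 'I_n, j <= k -> P k -> P j) ->
  P i = (i < #|[set j : 'I_n | P j]|).
Proof.
move=> down.
apply/idP/idP => [Pi|]; last first.
  apply: contraTT => nPi; rewrite -leqNgt -[leqRHS](card_ord_lt (ltnW (ltn_ord i))).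
  apply/subset_leq_card/subsetP => j; rewrite !inE ltnNge => Pj.
  by apply: contra nPi => ij; apply: down ij Pj.
rewrite -[leqLHS](card_ord_lt (ltn_ord i)).
by apply/subset_leq_card/subsetP => j; rewrite !inE ltnS => ji; apply: down ji Pi.
Qed.

Section Positions.

Variable n : nat.
Implicit Type h : nat -> nat.

(** The position of the j-th opener: j openers and all the closers [i] with
    [h i <= j] precede it. *)
Definition opos h (j : nat) : nat := j + #|[set i : 'I_n | h i <= j]|.

(** [i] closers and [h i] openers precede the i-th closer. *)
Definition cpos h (i : nat) : nat := i + h i.

(** The blocks are given by the values of their points, which makes the matching
    total in [h]; the points exist as ordinals only for a staircase. *)
Definition matching_of h : blocks n :=
  [set [set z : 'I_(2 * n) | (val z == opos h i) || (val z == cpos h i)] | i : 'I_n].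

Lemma eq_matching_of h h' : eq_upto n h h' -> matching_of h = matching_of h'.
Proof.
move=> E; apply: eq_imset => i; apply/setP => z; rewrite !inE /cpos E //.
congr ((_ == _ + _) || _); congr #|pred_of_set _|.
by apply/setP => j; rewrite !inE E.
Qed.

Variable h : nat -> nat.
Hypothesis h_st : staircase n h.

(** The closers that precede an opener are the first ones. *)
Lemma staircase_le_card (i : 'I_n) j : (h i <= j) = (i < #|[set k : 'I_n | h k <= j]|).
Proof.
apply: (@initial_segment_card n (fun k : 'I_n => h k <= j)) => k l kl.
by apply: leq_trans; apply: h_st.2.
Qed.

Lemma opos_lt_cpos (i j : 'I_n) : (opos h j < cpos h i) = (j < h i).
Proof. by have := staircase_le_card i j; rewrite /opos /cpos; lia. Qed.

Lemma cpos_lt_opos (i j : 'I_n) : (cpos h i < opos h j) = (h i <= j).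
Proof. by have := staircase_le_card i j; rewrite /opos /cpos; lia. Qed.

Lemma opos_ltE i j : (opos h i < opos h j) = (i < j).
Proof.
have mono a b : a <= b -> #|[set k : 'I_n | h k <= a]| <= #|[set k : 'I_n | h k <= b]|.
  move=> ab; apply/subset_leq_card/subsetP => k.
  by rewrite !inE => /leq_trans; apply.
by have := mono i j; have := mono j i; rewrite /opos; lia.
Qed.

Lemma cpos_ltE (i j : 'I_n) : (cpos h i < cpos h j) = (i < j).
Proof.
have := h_st.2 i j; have := h_st.2 j i; have := ltn_ord i; have := ltn_ord j.
rewrite /cpos; lia.
Qed.

Lemma opos_bound (i : 'I_n) : opos h i < 2 * n.
Proof.
have : #|[set k : 'I_n | h k <= i]| <= n by rewrite -[leqRHS]card_ord max_card.
by have := ltn_ord i; rewrite /opos; lia.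
Qed.

Lemma cpos_bound (i : 'I_n) : cpos h i < 2 * n.
Proof. by have := h_st.1 i (ltn_ord i); rewrite /cpos; have := ltn_ord i; lia. Qed.

Definition opener (i : 'I_n) : 'I_(2 * n) := Ordinal (opos_bound i).
Definition closer (i : 'I_n) : 'I_(2 * n) := Ordinal (cpos_bound i).

Lemma matching_ofE : matching_of h = [set [set opener i; closer i] | i : 'I_n].
Proof. by apply: eq_imset => i; apply/setP => z; rewrite !inE. Qed.

Lemma opener_lt_closer i : opener i < closer i.
Proof. by rewrite opos_lt_cpos; case/andP: (h_st.1 i (ltn_ord i)). Qed.

Lemma opener_neq_closer i j : opener i != closer j.
Proof.
apply/eqP => /(congr1 val) /= E; have := opos_lt_cpos j i; have := cpos_lt_opos j i.
rewrite E; lia.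
Qed.

Lemma opener_inj : injective opener.
Proof.
move=> i j /(congr1 val) /= E; apply: val_inj => /=.
by have := opos_ltE i j; have := opos_ltE j i; rewrite E; lia.
Qed.

Lemma closer_inj : injective closer.
Proof.
move=> i j /(congr1 val) /= E; apply: val_inj => /=.
by have := cpos_ltE i j; have := cpos_ltE j i; rewrite E; lia.
Qed.

(** The 2n openers and closers are distinct, so they fill all the positions. *)
Lemma opener_or_closer (z : 'I_(2 * n)) : exists i, z = opener i \/ z = closer i.
Proof.
pose f (x : 'I_n * bool) := if x.2 then opener x.1 else closer x.1.
have finj : injective f.
  move=> [i [|]] [j [|]]; rewrite /f /=.
  - by move/opener_inj ->.
  - by move/eqP; rewrite (negbTE (opener_neq_closer _ _)).
  - by move/esym/eqP; rewrite (negbTE (opener_neq_closer _ _)).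
  - by move/closer_inj ->.
have : z \in codom f.
  by apply: inj_card_onto => //; rewrite card_prod !card_ord card_bool mulnC.
by case/codomP => -[i [|]] ->; exists i; [left|right].
Qed.

Lemma arc_matching_of (x y : 'I_(2 * n)) :
  Defs.arc (matching_of h) x y <-> exists i, x = opener i /\ y = closer i.
Proof.
rewrite /Defs.arc matching_ofE; split=> [/andP[xy /imsetP[i _ E]]|[i [-> ->]]]; last first.
  by rewrite opener_lt_closer; apply: imset_f.
exists i; have := opener_lt_closer i.
have : x \in [set opener i; closer i] by rewrite -E set21.
have : y \in [set opener i; closer i] by rewrite -E set22.
rewrite !inE => /orP[]/eqP yE /orP[]/eqP xE oc; move: xy; rewrite xE yE ?ltnn //.
by rewrite ltnNge (ltnW oc).
Qed.

End Positions.

Lemma is_matching_intro n (M : blocks n) :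
  (forall B, B \in M -> #|B| = 2) ->
  (forall x, exists2 B, B \in M & x \in B) ->
  (forall B C x, B \in M -> C \in M -> x \in B -> x \in C -> B = C) ->
  is_matching M.
Proof.
move=> card2 cov dis; apply/andP; split; last first.
  by apply/forallP => B; apply/implyP => /card2 ->.
apply/and3P; split.
- apply/eqP/setP => x; rewrite inE; have [B BM xB] := cov x.
  by apply/bigcupP; exists B.
- apply/trivIsetP => B C BM CM; apply: contraR => /pred0Pn[x /andP[xB xC]].
  exact/eqP/(dis _ _ x).
- by apply/negP => /card2; rewrite cards0.
Qed.

Lemma matching_of_matching n h : staircase n h -> is_matching (matching_of n h).
Proof.
move=> st; rewrite (matching_ofE st); apply: is_matching_intro.
- by move=> B /imsetP[i _ ->]; rewrite cards2 opener_neq_closer.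
- move=> x; have [i xi] := opener_or_closer st x.
  exists [set opener h i; closer st i]; first exact: imset_f.
  by rewrite !inE; case: xi => ->; rewrite eqxx ?orbT.
- move=> B C x /imsetP[i _ ->] /imsetP[j _ ->]; rewrite !inE.
  have oc k l := negbTE (opener_neq_closer st k l).
  move=> /orP[]/eqP-> /orP[]/eqP.
  + by move/opener_inj ->.
  + by move/eqP; rewrite oc.
  + by move/esym/eqP; rewrite oc.
  + by move/closer_inj ->.
Qed.

(** A matching is handled through the involution that exchanges the endpoints of
    each arc. *)
Lemma matching_partner n (M : blocks n) : is_matching M ->
  exists p : 'I_(2 * n) -> 'I_(2 * n),
    [/\ involutive p, forall x, p x != x, set0 \notin M
      & forall (B : {set 'I_(2 * n)}) x, x \in B -> (B \in M) = (B == [set x; p x])].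
Proof.
move=> /andP[/and3P[/eqP cov /trivIsetP triv _] /forallP card2].
have ex x : exists y, (y != x) && ([set x; y] \in M).
  have : x \in cover M by rewrite cov inE.
  case/bigcupP => B BM xB; have := card2 B; rewrite BM /= => /cards2P[a [b [ab E]]].
  move: xB; rewrite E !inE => /orP[]/eqP ->; last by exists a; rewrite ab setUC -E.
  by exists b; rewrite eq_sym ab -E.
have [p pP] := fin_all_exists ex; exists p.
have uniqB (B C : {set 'I_(2 * n)}) x : B \in M -> C \in M -> x \in B -> x \in C -> B = C.
  move=> BM CM xB xC; apply/eqP; apply: contraTT xC => /(triv _ _ BM CM) dis.
  by rewrite (disjointFr dis xB).
have pne x : p x != x by case/andP: (pP x).
have pM x : [set x; p x] \in M by case/andP: (pP x).
split=> // [x||B x xB].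
- have := uniqB _ _ (p x) (pM x) (pM (p x)); rewrite !inE !eqxx orbT => /(_ isT isT).
  move/setP/(_ x); rewrite !inE eqxx /= eq_sym (negbTE (pne x)) /= => /esym/eqP E.
  by rewrite -E.
- by apply/negP => M0; have := card2 set0; rewrite M0 cards0.
apply/idP/eqP => [BM|-> //]; apply: (uniqB _ _ x) => //; exact: set21.
Qed.

(** Equal matchings match the arcs of [h1] with arcs of [h2] by an increasing
    map [e], so that [i <= e i]; hence the i-th closer of [h2] does not come
    after that of [h1], and conversely. *)
Lemma matching_of_inj n h h' : staircase n h -> staircase n h' ->
  matching_of n h = matching_of n h' -> eq_upto n h h'.
Proof.
have le h1 h2 : staircase n h1 -> staircase n h2 ->
    matching_of n h1 = matching_of n h2 -> forall i : 'I_n, h2 i <= h1 i.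
  move=> st1 st2 E.
  have ex (i : 'I_n) : exists j : 'I_n,
      opener h1 i = opener h2 j /\ closer st1 i = closer st2 j.
    by apply/(arc_matching_of st2); rewrite -E; apply/(arc_matching_of st1); exists i.
  have [e eP] := fin_all_exists ex.
  have emono (i j : 'I_n) : i < j -> e i < e j.
    have [oi _] := eP i; have [oj _] := eP j.
    rewrite -(opos_ltE n h1 i j) -(opos_ltE n h2 (e i) (e j)).
    by move: oi oj => /(congr1 val) /= -> /(congr1 val) /= ->.
  have ele (m : nat) (i : 'I_n) : i = m :> nat -> m <= e i.
    elim: m i => // m IHm i im; have mn : m < n by have := ltn_ord i; lia.
    have := emono (Ordinal mn) i; rewrite /= im ltnSn => /(_ isT).
    by have := IHm (Ordinal mn) erefl; lia.
  move=> i; have [_ /(congr1 val)] := eP i; rewrite /= /cpos.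
  have := st2.2 _ _ (ele i i erefl) (ltn_ord _); have := ele i i erefl; lia.
move=> st st' E i il; apply/eqP; rewrite eqn_leq.
by rewrite (le h' h st' st (esym E) (Ordinal il)) (le h h' st st' E (Ordinal il)).
Qed.

(** * Arcs around a nested pair in a Stoimenow matching *)

Section FromMatching.

Variables (n : nat) (M : blocks n) (p : 'I_(2 * n) -> 'I_(2 * n)).
Hypotheses (pK : involutive p) (p_neq : forall x, p x != x).
Hypothesis pM : forall (B : {set 'I_(2 * n)}) x, x \in B -> (B \in M) = (B == [set x; p x]).

Lemma partner_block x : [set x; p x] \in M.
Proof. by rewrite (pM (set21 _ _)). Qed.

Lemma arc_partner x y : Defs.arc M x y = (x < y) && (y == p x).
Proof.
rewrite /Defs.arc; case: ltnP => //= xy.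
rewrite (pM (set21 _ _)); apply/eqP/eqP => [|-> //].
move/setP/(_ y); rewrite !inE eqxx orbT => /esym/orP[/eqP yx|/eqP //].
by rewrite yx ltnn in xy.
Qed.

Section Nested.

Hypothesis stoi : stoimenow M.

(** Induction on [y - x]: the point after [x] either is the required closer or,
    the matching having no pair of arcs of the first type, is an opener whose
    arc ends after [p x], so it encloses [y] as well. *)
Lemma closer_between_openers (x y : 'I_(2 * n)) :
  x < y -> y < p y -> p y < p x -> exists e : 'I_(2 * n), [/\ p e < x, x < e & e < y].
Proof.
move=> xy yp pp.
have [m mE] : exists m, m = y - x by exists (y - x).
elim: m x mE xy pp => [|m IHm] x mE xy pp; first by lia.
have [x1 x1E] : exists x1 : 'I_(2 * n), x1 = x.+1 :> nat.
  have x1n : x.+1 < 2 * n by have := ltn_ord y; lia.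
  by exists (Ordinal x1n).
have notx (z : 'I_(2 * n)) : x < z -> z < p x -> p z <> x :> nat.
  by move=> xz zp /val_inj E; have := congr1 p E; rewrite pK => E'; move: zp; rewrite E' ltnn.
case/andP: stoi => /existsPn /(_ x) /existsPn /(_ x1) /existsPn
  /(_ (p x1)) /existsPn /(_ (p x)) + _.
rewrite x1E !arc_partner !eqxx /= !andbT => nt1.
have x1y : x1 <> y :> nat.
  by move=> /val_inj E; move: nt1; rewrite E; lia.
have px1 : p x1 <> x1 :> nat by move/val_inj/eqP; rewrite (negbTE (p_neq _)).
have := notx x1 => nx1.
case: (ltnP (p x1) x1) => [lt|ge]; first by exists x1; split; lia.
have [|||e [e1 e2 e3]] := IHm x1; [lia..|].
by have := notx e; exists e; split; lia.
Qed.

(** The mirror image: induction from [p x] leftwards, with the second type. *)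
Lemma opener_between_closers (x y : 'I_(2 * n)) :
  x < y -> y < p y -> p y < p x -> exists f : 'I_(2 * n), [/\ p y < f, f < p x & p x < p f].
Proof.
move=> xy yp pp; pose b := p x; have bE : p b = x by rewrite pK.
rewrite -/b in pp *.
have [m mE] : exists m, m = b - p y by exists (b - p y).
move: xy; rewrite -{}bE => xy.
(* The induction moves the outer closer [b], whose opener [p b] may change. *)
elim: m (b) mE xy pp => [|m IHm] {}b mE xy pp; first by lia.
have [b1 b1E] : exists b1 : 'I_(2 * n), b = b1.+1 :> nat.
  have b1n : b.-1 < 2 * n by have := ltn_ord b; lia.
  by exists (Ordinal b1n) => /=; lia.
have notb (z : 'I_(2 * n)) : p b < z -> z < b -> p z <> b :> nat.
  by move=> bz zb /val_inj E; move: bz; rewrite -E pK ltnn.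
case/andP: stoi => _ /existsPn /(_ (p b)) /existsPn /(_ (p b1)) /existsPn
  /(_ b1) /existsPn /(_ b).
rewrite -b1E !arc_partner !pK !eqxx /= !andbT => nt2.
have b1y : b1 <> p y :> nat.
  by move=> /val_inj E; move: nt2; rewrite E pK; lia.
have pb1 : p b1 <> b1 :> nat by move/val_inj/eqP; rewrite (negbTE (p_neq _)).
have := notb b1 => nb1.
case: (ltnP b1 (p b1)) => [lt|ge]; first by exists b1; split; lia.
have [|||f [f1 f2 f3]] := IHm b1; [lia..|].
by have := notb f; exists f; split; lia.
Qed.

End Nested.

End FromMatching.

(** * Patterns as eight increasing points *)

(** A relabelling of the eight points of a pattern, indexed from 1. *)
Definition increasing8 n (g : nat -> 'I_(2 * n)) : Prop :=
  forall i j, 0 < i -> i < j -> j <= 8 -> g i < g j.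

Lemma contains_arc8 n (M : blocks n) a1 b1 a2 b2 a3 b3 a4 b4 :
  contains M [set arc8 a1 b1; arc8 a2 b2; arc8 a3 b3; arc8 a4 b4] ->
  exists g : nat -> 'I_(2 * n), increasing8 g /\
    [/\ [set g a1; g b1] \in M, [set g a2; g b2] \in M,
        [set g a3; g b3] \in M & [set g a4; g b4] \in M].
Proof.
move=> /existsP[A /and3P[/subsetP AM _ /existsP[G /andP[/forallP Gmono /eqP AE]]]].
exists (fun i => G (inord i.-1 : 'I_8)); split.
  move=> i j i0 ij j8; have /forallP := Gmono (inord i.-1 : 'I_8).
  move/(_ (inord j.-1 : 'I_8)) => /implyP; apply.
  have i8 : i.-1 < 8 by lia.
  have j8' : j.-1 < 8 by lia.
  by rewrite !inordK //; lia.
have mem a b : arc8 a b \in [set arc8 a1 b1; arc8 a2 b2; arc8 a3 b3; arc8 a4 b4] ->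
    [set G (inord a.-1 : 'I_8); G (inord b.-1 : 'I_8)] \in M.
  move=> ab; apply: AM; rewrite AE; apply/imsetP; exists (arc8 a b) => //.
  by rewrite /arc8 imsetU1 imset_set1.
by split; apply: mem; rewrite !inE eqxx ?orbT.
Qed.

(** Distinctness of the eight endpoints ensures that the pattern has four
    blocks. *)
Lemma arc8_contains n (M : blocks n) (g : nat -> 'I_(2 * n)) a1 b1 a2 b2 a3 b3 a4 b4 :
  perm_eq [:: a1; b1; a2; b2; a3; b3; a4; b4] (iota 1 8) -> increasing8 g ->
  [set g a1; g b1] \in M -> [set g a2; g b2] \in M ->
  [set g a3; g b3] \in M -> [set g a4; g b4] \in M ->
  contains M [set arc8 a1 b1; arc8 a2 b2; arc8 a3 b3; arc8 a4 b4].
Proof.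
move=> perm gmono m1 m2 m3 m4.
set P := [set arc8 a1 b1; arc8 a2 b2; arc8 a3 b3; arc8 a4 b4].
pose G := [ffun x : 'I_(2 * 4) => g x.+1].
have Gmono (x y : 'I_(2 * 4)) : x < y -> G x < G y.
  by move=> xy; rewrite !ffunE; apply: gmono => //; have := ltn_ord y; lia.
have Ginj : injective G.
  move=> x y E; apply: val_inj; have := Gmono x y; have := Gmono y x; rewrite E /=; lia.
set l := [:: a1; b1; a2; b2; a3; b3; a4; b4] in perm.
have bound a : a \in l -> 0 < a <= 8 by rewrite (perm_mem perm) mem_iota.
have l_uniq : uniq l by rewrite (perm_uniq perm) iota_uniq.
have sl : size l = 8 by [].
have neq i j : i < 4 -> j < 4 -> i != j ->
    (arc8 (nth 0 l i.*2) (nth 0 l i.*2.+1) == arc8 (nth 0 l j.*2) (nth 0 l j.*2.+1)) = false.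
  move=> i4 j4 ij; apply/eqP => /setP/(_ (inord (nth 0 l i.*2).-1 : 'I_8)).
  have lb k : k < 8 -> 0 < nth 0 l k <= 8 by move=> k8; apply/bound/mem_nth; rewrite sl.
  have ne k : k < 8 -> k != i.*2 -> nth 0 l i.*2 != nth 0 l k.
    by move=> k8 ki; rewrite (nth_uniq 0 _ _ l_uniq) ?sl 1?eq_sym //; lia.
  have := lb i.*2; have := lb j.*2; have := lb j.*2.+1; have := ne j.*2; have := ne j.*2.+1.
  rewrite !inE eqxx -!val_eqE /=.
  move: (nth 0 l i.*2) (nth 0 l j.*2) (nth 0 l j.*2.+1) => a c d nd nc bd bc ba.
  rewrite !inordK; lia.
have Gval a : 0 < a <= 8 -> G (inord a.-1 : 'I_8) = g a.
  by move=> /andP[a0 a8]; rewrite ffunE inordK prednK.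
have cardP : #|P| = 4.
  rewrite /P (setUC _ [set arc8 a4 b4]) cardsU1 (setUC _ [set arc8 a3 b3]) cardsU1 cards2 !inE.
  have := neq 3 0 isT isT isT; have := neq 3 1 isT isT isT; have := neq 3 2 isT isT isT.
  have := neq 2 0 isT isT isT; have := neq 2 1 isT isT isT; have := neq 0 1 isT isT isT.
  by rewrite /= => -> -> -> -> -> ->.
apply/existsP; exists [set G @: B | B : {set 'I_(2 * 4)} in P]; apply/and3P; split.
- apply/subsetP => B /imsetP[C]; rewrite !inE => CP ->.
  have im a b : a \in l -> b \in l -> G @: arc8 a b = [set g a; g b].
    by move=> /bound ba /bound bb; rewrite /arc8 imsetU1 imset_set1 !Gval.
  by case/orP: CP => [/orP[/orP[]|]|] /eqP->; rewrite im // !inE eqxx ?orbT.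
- by rewrite card_imset ?cardP //; apply: imset_inj.
- by apply/existsP; exists G; rewrite eqxx andbT; apply/forallP => x;
    apply/forallP => y; apply/implyP; apply: Gmono.
Qed.

Definition nonnesting n (M : blocks n) : Prop :=
  forall x y x' y', Defs.arc M x y -> Defs.arc M x' y' -> x < x' -> y < y'.

Lemma nonnesting_stoimenow n (M : blocks n) : nonnesting M -> stoimenow M.
Proof.
move=> nn; apply/andP; split.
  apply/existsPn => x; apply/existsPn => x1; apply/existsPn => y1; apply/existsPn => y.
  by apply/and4P => -[/eqP x1E a a1 lt]; have := nn _ _ _ _ a a1; lia.
apply/existsPn => x; apply/existsPn => x1; apply/existsPn => y1; apply/existsPn => y.
by apply/and4P => -[/eqP x1E a a1 lt]; have := nn _ _ _ _ a a1 lt; lia.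
Qed.

Lemma nonnesting_avoids_P1 n (M : blocks n) : nonnesting M -> ~~ contains M P1.
Proof.
move=> nn; apply/negP => /contains_arc8[g [gmono [_ a b _]]].
have := nn (g 2) (g 7) (g 4) (g 5); rewrite /Defs.arc a b.
rewrite (gmono 2 7) // (gmono 4 5) // (gmono 2 4) // => /(_ isT isT isT).
by rewrite ltnNge ltnW // gmono.
Qed.

Lemma seq8_increasing n (x0 : 'I_(2 * n)) (t : seq 'I_(2 * n)) :
  size t = 8 -> sorted ltn (map val t) -> increasing8 (fun i => nth x0 t i.-1).
Proof.
move=> st so i j i0 ij j8.
have := sorted_ltn_nth ltn_trans (val x0) so i.-1 j.-1.
by rewrite !inE size_map st !(nth_map x0) ?st; [apply; lia|lia..].
Qed.

(** * Staircases from nonnesting matchings *)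

Section AvoidP1.

Variables (n : nat) (M : blocks n) (p : 'I_(2 * n) -> 'I_(2 * n)).
Hypotheses (pK : involutive p) (p_neq : forall x, p x != x).
Hypothesis pM : forall (B : {set 'I_(2 * n)}) x, x \in B -> (B \in M) = (B == [set x; p x]).

(** A nesting extends to P1: the arc of the closer found between the two openers
    and that of the opener found between the two closers surround it. *)
Lemma partner_mono : stoimenow M -> ~~ contains M P1 ->
  forall x y : 'I_(2 * n), x < p x -> y < p y -> x < y -> p x < p y.
Proof.
move=> stoi noP1 x y xp yp xy; rewrite ltnNge; apply: contra noP1 => le.
have lt : p y < p x.
  by move: le; rewrite leq_eqVlt => /orP[/eqP/val_inj/(can_inj pK) E|//]; rewrite E ltnn in xy.
have [e [e1 e2 e3]] := closer_between_openers pK p_neq pM stoi xy yp lt.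
have [f [f1 f2 f3]] := opener_between_closers pK p_neq pM stoi xy yp lt.
have bl z : [set z; p z] \in M by apply: partner_block.
pose g := nth x [:: p e; x; e; y; p y; f; p x; p f].
apply: (@arc8_contains _ _ (fun i => g i.-1)) => //=.
- by apply: seq8_increasing => //=; rewrite e1 e2 e3 yp f1 f2 f3.
- by rewrite /g /= setUC.
Qed.

Hypothesis M0 : set0 \notin M.

Let O := [set x : 'I_(2 * n) | x < p x].

Lemma card_openers : #|O| = n.
Proof.
have : #|O| + #|~: O| = 2 * n by rewrite cardsC card_ord.
have -> : ~: O = p @: O.
  apply/setP => x; rewrite !inE; apply/idP/imsetP => [nx|[y]]; last first.
    by rewrite inE => yp ->; rewrite pK -leqNgt ltnW.
  exists (p x); rewrite ?pK // inE pK.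
  by have := p_neq x; rewrite -val_eqE /=; lia.
rewrite card_imset; last exact: can_inj pK.
by lia.
Qed.

Let o (i : 'I_n) : 'I_(2 * n) := enum_val (cast_ord (esym card_openers) i).

Lemma nth_opener_mem i : o i < p (o i).
Proof. by have := enum_valP (cast_ord (esym card_openers) i); rewrite inE. Qed.

Lemma nth_opener_onto (x : 'I_(2 * n)) : x < p x -> exists i, x = o i.
Proof.
move=> xp; have xO : x \in O by rewrite inE.
exists (cast_ord card_openers (enum_rank_in xO x)).
by rewrite /o cast_ord_comp cast_ord_id enum_rankK_in.
Qed.

Lemma nth_opener_mono (i j : 'I_n) : (o i < o j) = (i < j).
Proof.
have vE k : val (o k) = nth 0 (vals O) k.
  by rewrite /o (enum_val_nth (o k)) /vals (nth_map (o k)) // -cardE card_openers.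
have lt (k l : 'I_n) : k < l -> o k < o l.
  move=> kl; rewrite !vE; have := @vals_gap _ O k l (ltnW kl).
  by rewrite card_openers => /(_ (ltn_ord l)); lia.
case: (ltngtP i j) => [/lt //|/lt|/val_inj ->]; last by rewrite ltnn.
by move/ltnW; rewrite leqNgt => /negbTE.
Qed.

Hypothesis pmono : forall x y : 'I_(2 * n), x < p x -> y < p y -> x < y -> p x < p y.

Lemma nth_closer_mono (i j : 'I_n) : (p (o i) < p (o j)) = (i < j).
Proof.
have lt (k l : 'I_n) : k < l -> p (o k) < p (o l).
  by move=> kl; apply: pmono; rewrite ?nth_opener_mem ?nth_opener_mono.
case: (ltngtP i j) => [/lt //|/lt|/val_inj ->]; last by rewrite ltnn.
by move/ltnW; rewrite leqNgt => /negbTE.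
Qed.

(** A position is the number of openers plus the number of closers before it;
    this is what turns the matching into a staircase. *)
Lemma position_count (x : 'I_(2 * n)) :
  x = #|[set i | o i < x]| + #|[set i | p (o i) < x]| :> nat.
Proof.
have oinj : injective o by move=> i j /enum_val_inj/cast_ord_inj.
rewrite -[LHS](card_ord_lt (ltnW (ltn_ord x))) -(cardsID O).
rewrite -(card_imset _ oinj).
rewrite -[in RHS](card_imset [set i | p (o i) < x] (inj_comp (can_inj pK) oinj)).
congr (_ + _); apply: eq_card => z; rewrite !inE.
  apply/andP/imsetP => [[zx /nth_opener_onto[i zE]]|[i]].
    by exists i; rewrite // inE -zE.
  by rewrite inE => ix ->; rewrite nth_opener_mem.
apply/andP/imsetP => [[zO zx]|[i]]; last first.
  by rewrite inE => ix ->; rewrite /= pK -leqNgt ltnW // nth_opener_mem.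
have : p z < p (p z) by rewrite pK; have := p_neq z; rewrite -val_eqE /=; lia.
by case/nth_opener_onto => i zE; exists i; rewrite ?inE /= -zE pK.
Qed.

(** The staircase counts, for each [i], the openers before the closer of the
    i-th opener; monotony of the partner on the openers makes this closer the
    i-th one. *)
Lemma nonnesting_matching_of : exists2 h, staircase n h & M = matching_of n h.
Proof.
pose h (i : nat) := if insub i is Some i' then #|[set j | o j < p (o i')]| else 0.
have hE (i : 'I_n) : h i = #|[set j | o j < p (o i)]| by rewrite /h valK.
have cE (i : 'I_n) : cpos h i = p (o i).
  rewrite (position_count (p (o i))) /cpos hE addnC; congr (_ + _).
  rewrite -[LHS](card_ord_lt (ltnW (ltn_ord i))).
  by apply: eq_card => j; rewrite !inE nth_closer_mono.
have lthE (i j : 'I_n) : (o i < p (o j)) = (i < h j).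
  rewrite hE; apply: (initial_segment_card (P := fun k => o k < p (o j))) => k l kl.
  by apply: leq_ltn_trans; rewrite leqNgt nth_opener_mono -leqNgt.
have oE (i : 'I_n) : opos n h i = o i.
  rewrite (position_count (o i)) /opos; congr (_ + _).
    rewrite -[LHS](card_ord_lt (ltnW (ltn_ord i))).
    by apply: eq_card => j; rewrite !inE nth_opener_mono.
  apply: eq_card => j; rewrite !inE leqNgt -lthE -leqNgt leq_eqVlt.
  case: eqP => // /val_inj E; have := nth_opener_mem i; have := nth_opener_mem j.
  by rewrite -E pK ltnNge => /negbTE lt /ltnW; rewrite lt.
exists h.
  split=> [i il|i j ij jn].
    have := lthE (Ordinal il) (Ordinal il); rewrite nth_opener_mem /= => /esym ->.
    by rewrite (hE (Ordinal il)) -[leqRHS]card_ord max_card.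
  have il := leq_ltn_trans ij jn.
  rewrite (hE (Ordinal il)) (hE (Ordinal jn)).
  apply/subset_leq_card/subsetP => k; rewrite !inE => /leq_trans; apply.
  by rewrite leqNgt nth_closer_mono -leqNgt.
have blE (i : 'I_n) :
    [set z : 'I_(2 * n) | (val z == opos n h i) || (val z == cpos h i)] =
    [set o i; p (o i)].
  by apply/setP => z; rewrite !inE -!val_eqE /= oE cE.
apply/setP => B; apply/idP/imsetP => [BM|[i _ ->]]; last first.
  by rewrite blE (pM (set21 _ _)).
have [i oB] : exists i, o i \in B.
  have [B0|[x xB]] := set_0Vmem B.
    by move: BM; rewrite B0 (negbTE M0).
  have := p_neq x; rewrite -val_eqE /= neq_ltn => /orP[lt|lt].
    have : p x < p (p x) by rewrite pK.
    case/nth_opener_onto => i iE; exists i; rewrite -iE.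
    by move: BM; rewrite (pM xB) => /eqP ->; rewrite set22.
  by have [i iE] := nth_opener_onto lt; exists i; rewrite -iE.
by exists i => //; rewrite blE; apply/eqP; rewrite -(pM oB).
Qed.

End AvoidP1.

Lemma stoimenow_avoiding_P1 n (M : blocks n) :
  [&& is_matching M, stoimenow M & ~~ contains M P1] <->
  exists2 h, staircase n h & M = matching_of n h.
Proof.
split=> [/and3P[Mm stoi noP1]|[h st ->]].
  have [p [pK p_neq M0 pM]] := matching_partner Mm.
  apply: (nonnesting_matching_of pK p_neq pM M0).
  exact: (partner_mono pK p_neq pM stoi noP1).
have nn : nonnesting (matching_of n h).
  move=> x y x' y' /(arc_matching_of st)[i [-> ->]] /(arc_matching_of st)[j [-> ->]].
  by rewrite /= opos_ltE cpos_ltE.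
by rewrite matching_of_matching // nonnesting_stoimenow // nonnesting_avoids_P1.
Qed.

(** * Patterns read on the staircase *)

Section PatternsInStaircase.

Variables (n : nat) (h : nat -> nat).
Hypothesis h_st : staircase n h.

Lemma pattern_arcs a1 b1 a2 b2 a3 b3 a4 b4 :
  all (fun ab => [&& 0 < ab.1, ab.1 < ab.2 & ab.2 <= 8])
    [:: (a1, b1); (a2, b2); (a3, b3); (a4, b4)] ->
  contains (matching_of n h) [set arc8 a1 b1; arc8 a2 b2; arc8 a3 b3; arc8 a4 b4] ->
  exists (g : nat -> 'I_(2 * n)) (a b c d : 'I_n), increasing8 g /\
    [/\ g a1 = opos n h a :> nat /\ g b1 = cpos h a :> nat,
        g a2 = opos n h b :> nat /\ g b2 = cpos h b :> nat,
        g a3 = opos n h c :> nat /\ g b3 = cpos h c :> nat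
      & g a4 = opos n h d :> nat /\ g b4 = cpos h d :> nat].
Proof.
move=> /and5P[ab1 ab2 ab3 ab4 _] /contains_arc8[g [gmono [m1 m2 m3 m4]]].
have arcE a b : [&& 0 < a, a < b & b <= 8] -> [set g a; g b] \in matching_of n h ->
    exists i : 'I_n, g a = opos n h i :> nat /\ g b = cpos h i :> nat.
  move=> /and3P[a0 ab b8] m.
  have : Defs.arc (matching_of n h) (g a) (g b) by rewrite /Defs.arc m gmono.
  by case/(arc_matching_of h_st) => i [-> ->]; exists i.
have [a ?] := arcE _ _ ab1 m1; have [b ?] := arcE _ _ ab2 m2.
have [c ?] := arcE _ _ ab3 m3; have [d ?] := arcE _ _ ab4 m4.
by exists g, a, b, c, d.
Qed.

(** [t] lists the eight points from left to right, so that an occurrence is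
    checked by comparing consecutive points. *)
Lemma arcs_pattern (t : seq 'I_(2 * n)) (x0 : 'I_(2 * n))
    a1 b1 a2 b2 a3 b3 a4 b4 (a b c d : 'I_n) :
  perm_eq [:: a1; b1; a2; b2; a3; b3; a4; b4] (iota 1 8) ->
  size t = 8 -> sorted ltn (map val t) ->
  nth x0 t a1.-1 = opener h a -> nth x0 t b1.-1 = closer h_st a ->
  nth x0 t a2.-1 = opener h b -> nth x0 t b2.-1 = closer h_st b ->
  nth x0 t a3.-1 = opener h c -> nth x0 t b3.-1 = closer h_st c ->
  nth x0 t a4.-1 = opener h d -> nth x0 t b4.-1 = closer h_st d ->
  contains (matching_of n h) [set arc8 a1 b1; arc8 a2 b2; arc8 a3 b3; arc8 a4 b4].
Proof.
move=> perm st so o1 c1 o2 c2 o3 c3 o4 c4.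
have block i : [set opener h i; closer h_st i] \in matching_of n h.
  by rewrite (matching_ofE h_st); apply: imset_f.
by apply: (arc8_contains perm (seq8_increasing x0 st so));
  rewrite ?(o1, c1, o2, c2, o3, c3, o4, c4) block.
Qed.

Lemma four_chain_ord (R : nat -> nat -> nat -> nat -> Prop) :
  four_chain n R <-> exists a b c d : 'I_n, [/\ a < b, b < c & c < d] /\ R a b c d.
Proof.
split=> [[a [b [c [d [[ab bc cd dn] r]]]]]|[a [b [c [d [[ab bc cd] r]]]]]].
  have cn := ltn_trans cd dn; have bn := ltn_trans bc cn; have an := ltn_trans ab bn.
  by exists (Ordinal an), (Ordinal bn), (Ordinal cn), (Ordinal dn).
by exists a, b, c, d.
Qed.

Let rel_pos := (opos_ltE n h, cpos_ltE h_st, opos_lt_cpos h_st, cpos_lt_opos h_st).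

(** The points of an occurrence being increasing, comparing consecutive points
    and consecutive openers gives the conditions on the four indices; they in
    turn imply all the comparisons of consecutive points. *)
Lemma contains_P2 : contains (matching_of n h) P2 <-> hasP2 n h.
Proof.
rewrite /hasP2 four_chain_ord; split.
  case/pattern_arcs => // g [a [b [c [d [gm [[g1 g3] [g2 g5] [g4 g7] [g6 g8]]]]]]].
  exists a, b, c, d; move: (gm 1 2) (gm 2 3) (gm 3 4) (gm 4 5) (gm 5 6)
    (gm 6 7) (gm 7 8) (gm 2 4) (gm 4 6).
  rewrite ?(g1, g2, g3, g4, g5, g6, g7, g8) !rel_pos => *; split; split; lia.
move=> [a [b [c [d [[ab bc cd] [r1 r2 r3]]]]]].
pose o := @opener n h; pose k := closer h_st.
have := @arcs_pattern [:: o a; o b; k a; o c; k b; o d; k c; k d] (o a)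
  1 3 2 5 4 7 6 8 a b c d.
have := h_st.1 a (ltn_ord a); have := h_st.1 d (ltn_ord d) => ha hd.
by apply => //=; rewrite !rel_pos; lia.
Qed.

Lemma contains_P3 : contains (matching_of n h) P3 <-> hasP3 n h.
Proof.
rewrite /hasP3 four_chain_ord; split.
  case/pattern_arcs => // g [a [b [c [d [gm [[g1 g2] [g3 g5] [g4 g6] [g7 g8]]]]]]].
  exists a, b, c, d; move: (gm 1 2) (gm 2 3) (gm 3 4) (gm 4 5) (gm 5 6)
    (gm 6 7) (gm 7 8) (gm 1 3) (gm 4 7).
  rewrite ?(g1, g2, g3, g4, g5, g6, g7, g8) !rel_pos => *; split; split; lia.
move=> [a [b [c [d [[ab bc cd] [r1 r2 r3]]]]]].
pose o := @opener n h; pose k := closer h_st.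
have := @arcs_pattern [:: o a; k a; o b; o c; k b; k c; o d; k d] (o a)
  1 2 3 5 4 6 7 8 a b c d.
have := h_st.1 a (ltn_ord a); have := h_st.1 d (ltn_ord d) => ha hd.
by apply => //=; rewrite !rel_pos; lia.
Qed.

Lemma contains_P4 : contains (matching_of n h) P4 <-> hasP4 n h.
Proof.
rewrite /hasP4 four_chain_ord; split.
  case/pattern_arcs => // g [a [b [c [d [gm [[g1 g2] [g3 g5] [g4 g7] [g6 g8]]]]]]].
  exists a, b, c, d; move: (gm 1 2) (gm 2 3) (gm 3 4) (gm 4 5) (gm 5 6)
    (gm 6 7) (gm 7 8) (gm 1 3) (gm 4 6).
  rewrite ?(g1, g2, g3, g4, g5, g6, g7, g8) !rel_pos => *; split; split; lia.
move=> [a [b [c [d [[ab bc cd] [r1 r2 r3]]]]]].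
pose o := @opener n h; pose k := closer h_st.
have := @arcs_pattern [:: o a; k a; o b; o c; k b; o d; k c; k d] (o a)
  1 2 3 5 4 7 6 8 a b c d.
have := h_st.1 a (ltn_ord a); have := h_st.1 d (ltn_ord d) => ha hd.
by apply => //=; rewrite !rel_pos; lia.
Qed.

Lemma contains_P5 : contains (matching_of n h) P5 <-> hasP5 n h.
Proof.
rewrite /hasP5 four_chain_ord; split.
  case/pattern_arcs => // g [a [b [c [d [gm [[g1 g3] [g2 g5] [g4 g6] [g7 g8]]]]]]].
  exists a, b, c, d; move: (gm 1 2) (gm 2 3) (gm 3 4) (gm 4 5) (gm 5 6)
    (gm 6 7) (gm 7 8) (gm 2 4) (gm 4 7).
  rewrite ?(g1, g2, g3, g4, g5, g6, g7, g8) !rel_pos => *; split; split; lia.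
move=> [a [b [c [d [[ab bc cd] [r1 r2 r3]]]]]].
pose o := @opener n h; pose k := closer h_st.
have := @arcs_pattern [:: o a; o b; k a; o c; k b; k c; o d; k d] (o a)
  1 3 2 5 4 6 7 8 a b c d.
have := h_st.1 a (ltn_ord a); have := h_st.1 d (ltn_ord d) => ha hd.
by apply => //=; rewrite !rel_pos; lia.
Qed.

End PatternsInStaircase.

(** * Counting *)

(** Shifting by one turns the pairs [0 < p < q <= k] into pairs of ordinals
    below [k]. *)
Lemma card_two_families k (G : {set blocks k.+1})
    (phi : {set 'I_k} -> nat -> nat) (psi : nat -> nat -> nat -> nat) :
  (forall A, staircase k.+1 (phi A)) ->
  (forall p q, 0 < p -> p < q -> q < k.+1 -> staircase k.+1 (psi p q)) ->
  (forall A B, eq_upto k.+1 (phi A) (phi B) -> A = B) ->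
  (forall p q p' q', 0 < p -> p < q -> q < k.+1 -> 0 < p' -> p' < q' -> q' < k.+1 ->
     eq_upto k.+1 (psi p q) (psi p' q') -> (p, q) = (p', q')) ->
  (forall A p q, 0 < p -> p < q -> q < k.+1 -> ~ eq_upto k.+1 (phi A) (psi p q)) ->
  (forall M, M \in G <-> exists2 h, staircase k.+1 h &
     M = matching_of k.+1 h /\
     ((exists A, eq_upto k.+1 h (phi A)) \/
      exists p q, [/\ 0 < p, p < q, q < k.+1 & eq_upto k.+1 h (psi p q)])) ->
  #|G| = 2 ^ k + 'C(k, 2).
Proof.
move=> st_phi st_psi phi_inj psi_inj disj GE.
pose f A := matching_of k.+1 (phi A).
pose g (x : 'I_k * 'I_k) := matching_of k.+1 (psi x.1.+1 x.2.+1).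
pose D := [set x : 'I_k * 'I_k | x.1 < x.2].
have lt (x : 'I_k * 'I_k) : x \in D -> [/\ 0 < x.1.+1, x.1.+1 < x.2.+1 & x.2.+1 < k.+1].
  by rewrite inE => xx; split; rewrite ?ltnS.
have -> : G = f @: setT :|: g @: D.
  apply/setP => M; rewrite inE; apply/idP/idP => [/GE[h st [-> [[A E]|]]]|].
  - by apply/orP; left; rewrite (eq_matching_of E) imset_f.
  - move=> [p [q [p0 pq qk E]]]; apply/orP; right; rewrite (eq_matching_of E).
    have pk : p.-1 < k by lia.
    have qk' : q.-1 < k by lia.
    apply/imsetP; exists (Ordinal pk, Ordinal qk'); first by rewrite inE /=; lia.
    by rewrite /g /= !prednK //; lia.
  case/orP => /imsetP[x xD ->]; apply/GE.
    by exists (phi x) => //; split=> //; left; exists x.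
  have [x0 xx xk] := lt x xD.
  exists (psi x.1.+1 x.2.+1); first exact: st_psi.
  by split=> //; right; exists x.1.+1, x.2.+1.
have f_inj : injective f by move=> A B /matching_of_inj E; apply/phi_inj/E.
have g_inj : {in D &, injective g}.
  move=> x y /lt[x0 xx xk] /lt[y0 yy yk] /matching_of_inj E.
  case: (psi_inj _ _ _ _ x0 xx xk y0 yy yk (E (st_psi _ _ x0 xx xk) (st_psi _ _ y0 yy yk))).
  by case: x {x0 xx xk E} => x1 x2; case: y {y0 yy yk} => y1 y2 /= /val_inj -> /val_inj ->.
have card_f : #|f @: [set: {set 'I_k}]| = 2 ^ k.
  by rewrite card_imset // -powersetT card_powerset cardsT card_ord.
rewrite cardsU card_f (card_in_imset g_inj) card_ltn_pairs.
suff -> : f @: setT :&: g @: D = set0 by rewrite cards0 subn0.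
apply/setP => M; rewrite !inE; apply/negP => /andP[/imsetP[A _ ->] /imsetP[x /lt[x0 xx xk]]].
by move=> /(matching_of_inj (st_phi A) (st_psi _ _ x0 xx xk)); apply: disj.
Qed.

Lemma avoids_iff (b : bool) (P : Prop) : (b <-> P) -> (~~ b <-> ~ P).
Proof. by move=> [bP Pb]; split=> [nb /Pb|nP]; [apply/negP|apply/negP => /bP]. Qed.

Lemma stoimenow_avoidingE n (S : seq (blocks 4)) (Q : (nat -> nat) -> Prop) :
  (forall h, staircase n h -> all (fun P => ~~ contains (matching_of n h) P) S <-> Q h) ->
  forall M, M \in stoimenow_avoiding n (P1 :: S) <->
    exists2 h, staircase n h & M = matching_of n h /\ Q h.
Proof.
move=> SQ M; rewrite inE /=; split=> [/and4P[Mm stoi noP1 noS]|[h st [ME Qh]]].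
  have [|h st ME] := (stoimenow_avoiding_P1 M).1; first exact/and3P.
  by exists h => //; split=> //; apply/SQ => //; rewrite -ME.
have /and3P[Mm stoi noP1] := (stoimenow_avoiding_P1 M).2 (ex_intro2 _ _ h st ME).
by rewrite Mm stoi noP1 /=; rewrite ME; apply/SQ.
Qed.

Lemma card_avoiding_P1245 k :
  #|stoimenow_avoiding k.+1 [:: P1; P2; P4; P5]| = 2 ^ k + 'C(k, 2).
Proof.
apply: (@card_two_families _ _ (@next_cut k) (two_step k.+1)).
- exact: staircase_next_cut.
- exact: staircase_two_step.
- exact: next_cut_inj.
- exact: two_step_inj.
- by move=> A p q p0 pq qk /(two_step_not_weak p0 pq qk); apply; exact: weak_next_cut.
apply: stoimenow_avoidingE => h st; rewrite /= andbT.
have c2 := avoids_iff (contains_P2 st); have c4 := avoids_iff (contains_P4 st).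
have c5 := avoids_iff (contains_P5 st); have eqv := avoid_P245 st.
split=> [/and3P[/c2 n2 /c4 n4 /c5 n5]|fam].
  case: (eqv.1 (conj n2 (conj n4 n5))) => [wk|]; last by right.
  by left; apply: weak_eq_next_cut.
have [|n2 [n4 n5]] := eqv.2.
  by case: fam => [[A E]|]; [left; apply: (weak_congr E); exact: weak_next_cut|right].
by apply/and3P; split; [apply/c2|apply/c4|apply/c5].
Qed.

Lemma card_avoiding_P1345 k :
  #|stoimenow_avoiding k.+1 [:: P1; P3; P4; P5]| = 2 ^ k + 'C(k, 2).
Proof.
apply: (@card_two_families _ _ (@shifted_vals k) (chain_step k.+1)).
- exact: staircase_shifted_vals.
- exact: staircase_chain_step.
- exact: shifted_vals_inj.
- exact: chain_step_inj.
- by move=> A p q p0 pq qk /(chain_step_not_flat p0 pq qk); apply; exact: flat_shifted_vals.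
apply: stoimenow_avoidingE => h st; rewrite /= andbT.
have c3 := avoids_iff (contains_P3 st); have c4 := avoids_iff (contains_P4 st).
have c5 := avoids_iff (contains_P5 st); have eqv := avoid_P345 st.
split=> [/and3P[/c3 n3 /c4 n4 /c5 n5]|fam].
  case: (eqv.1 (conj n3 (conj n4 n5))) => [fl|]; last by right.
  by left; apply: flat_eq_shifted_vals.
have [|n3 [n4 n5]] := eqv.2.
  by case: fam => [[A E]|]; [left; apply: (flat_congr E); exact: flat_shifted_vals|right].
by apply/and3P; split; [apply/c3|apply/c4|apply/c5].
Qed.

(** With no arc there is no pattern, and one staircase up to agreement. *)
Lemma card_avoiding_0 S : S = [:: P1; P2; P4; P5] \/ S = [:: P1; P3; P4; P5] ->
  #|stoimenow_avoiding 0 S| = 1.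
Proof.
move=> hS.
have noarg (h : nat -> nat) : staircase 0 h by split.
have notin (R : nat -> nat -> nat -> nat -> Prop) : ~ four_chain 0 R.
  by move=> [a [b [c [d []]]]] [].
suff -> : stoimenow_avoiding 0 S = [set matching_of 0 id] by rewrite cards1.
have [S' -> allS'] : exists2 S', S = P1 :: S' &
   forall h, all (fun P => ~~ contains (matching_of 0 h) P) S' <-> True.
  case: hS => ->; eexists; try reflexivity; move=> h; split=> // _ /=;
  apply/and4P; split=> //; apply/negP.
  - by move/(contains_P2 (noarg h))/notin.
  - by move/(contains_P4 (noarg h))/notin.
  - by move/(contains_P5 (noarg h))/notin.
  - by move/(contains_P3 (noarg h))/notin.
  - by move/(contains_P4 (noarg h))/notin.
  - by move/(contains_P5 (noarg h))/notin.
apply/setP => M; rewrite in_set1.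
have E := stoimenow_avoidingE (fun h _ => allS' h).
apply/idP/idP => [MS|/eqP ->].
  by have [h _ [-> _]] := (E M).1 MS; apply/eqP; apply: eq_matching_of => i; rewrite ltn0.
by apply/E; exists id.
Qed.

(** * The generating function *)

Import GRing.Theory.
Local Open Scope ring_scope.

(** Coefficients up to [n] of a product only involve those of its factors, so
    identities between products of series reduce to polynomials. *)
Lemma fps_mul_trunc (R : nzRingType) (p q : {poly R}) (f g : fps R) n :
  (forall i, (i <= n)%N -> p`_i = f i) -> (forall i, (i <= n)%N -> q`_i = g i) ->
  fps_mul f g n = (p * q)`_n.
Proof.
move=> pf qg; rewrite coefM; apply: eq_bigr => i _.
by rewrite pf ?qg // ?leq_subr // -ltnS.
Qed.

Lemma fps_mulA (R : nzRingType) (f g h : fps R) :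
  fps_mul f (fps_mul g h) =1 fps_mul (fps_mul f g) h.
Proof.
move=> n; pose t (u : fps R) : {poly R} := \poly_(i < n.+1) u i.
have tE u i : (i <= n)%N -> (t u)`_i = u i by rewrite coef_poly ltnS => ->.
have tM u v i : (i <= n)%N -> (t u * t v)`_i = fps_mul u v i.
  move=> le; rewrite (@fps_mul_trunc _ (t u) (t v)) // => j ji; apply: tE;
    exact: leq_trans ji le.
rewrite (@fps_mul_trunc _ (t f) (t g * t h)) //; try by move=> *; rewrite ?tE ?tM.
rewrite (@fps_mul_trunc _ (t f * t g) (t h)) ?mulrA //; by move=> *; rewrite ?tE ?tM.
Qed.

Lemma fps_div_eq (R : comUnitRingType) (f g c : fps R) :
  g 0%N \is a GRing.unit -> fps_mul c g =1 f -> c =1 fps_div f g.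
Proof.
move=> gU cg n.
have -> : fps_div f g n = fps_mul (fps_mul c g) (fps_inv g) n.
  by apply: eq_bigr => i _; rewrite cg.
rewrite -fps_mulA.
have -> : fps_mul c (fps_mul g (fps_inv g)) n = fps_mul c (fps_poly 1) n.
  by apply: eq_bigr => i _; rewrite fps_mulV.
rewrite /fps_mul big_ord_recr /= subnn /fps_poly coef1 eqxx mulr1 big1 ?add0r // => i _.
by rewrite coef1 subn_eq0 leqNgt ltn_ord mulr0.
Qed.

Lemma fps_mulC (R : comNzRingType) (f g : fps R) : fps_mul f g =1 fps_mul g f.
Proof.
move=> n; rewrite /fps_mul (reindex_inj rev_ord_inj) /=.
apply: eq_bigr => i _; rewrite subSS mulrC subKn // -ltnS; exact: ltn_ord.
Qed.

Definition avoiding_count (n : nat) : nat := if n is k.+1 then (2 ^ k + 'C(k, 2))%N else 1%N.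

(** The sequence satisfies the recurrence read on the denominator
    1 - 5x + 9x^2 - 7x^3 + 2x^4 from the index 5 on, and its first five terms
    give the numerator. *)
Lemma avoiding_count_fps :
  (fun n => (avoiding_count n)%:R : rat) =1
  fps_div
    (fps_poly (1 - 4 *: 'X + 6 *: 'X^2 - 3 *: 'X^3 - 'X^4 : {poly rat}))
    (fps_poly ((1 - 'X) ^+ 3 * (1 - 2 *: 'X) : {poly rat})).
Proof.
set den := (X in fps_div _ (fps_poly X)).
have denE : den = 1 - 5%:R *: 'X + 9%:R *: 'X^2 - 7%:R *: 'X^3 + 2%:R *: 'X^4.
  rewrite /den -!mul_polyC; ring.
have dc i : den`_i = nth 0 [:: 1; - 5%:R; 9%:R; - 7%:R; 2%:R] i.
  rewrite denE !(coefD, coefN, coefZ, coefX, coefXn, coef1).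
  by case: i => [|[|[|[|[|i]]]]] //=; rewrite ?nth_nil; ring.
apply: fps_div_eq; first by rewrite /fps_poly dc /= unitr1.
move=> n; rewrite fps_mulC /fps_mul /fps_poly.
have nc i : (1 - 4 *: 'X + 6 *: 'X^2 - 3 *: 'X^3 - 'X^4 : {poly rat})`_i =
    nth 0 [:: 1; - 4%:R; 6%:R; - 3%:R; - 1] i.
  rewrite !(coefD, coefN, coefZ, coefX, coefXn, coef1).
  by case: i => [|[|[|[|[|i]]]]] //=; rewrite ?nth_nil; ring.
rewrite nc; under eq_bigr do rewrite dc.
have [c0 c1 c2 c3 c4] : [/\ avoiding_count 0 = 1, avoiding_count 1 = 1,
  avoiding_count 2 = 2, avoiding_count 3 = 5 & avoiding_count 4 = 11]%N by [].
have cS m : avoiding_count m.+1 = (2 ^ m + 'C(m, 2))%N by [].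
move: avoiding_count c0 c1 c2 c3 c4 cS => c c0 c1 c2 c3 c4 cS.
case: n => [|[|[|[|[|n]]]]].
- by rewrite !big_ord_recl big_ord0 /= c0; ring.
- by rewrite !big_ord_recl big_ord0 /= /bump /= !subSS !subn0 c0 c1; ring.
- by rewrite !big_ord_recl big_ord0 /= /bump /= !subSS !subn0 c0 c1 c2; ring.
- by rewrite !big_ord_recl big_ord0 /= /bump /= !subSS !subn0 c0 c1 c2 c3; ring.
- by rewrite !big_ord_recl big_ord0 /= /bump /= !subSS !subn0 c0 c1 c2 c3 c4; ring.
rewrite !big_ord_recl big1 => [|i _]; last by rewrite nth_default ?mul0r.
rewrite /bump /= !subSS !subn0 /= !cS !binS !bin0 !bin1 !expnS.
rewrite !(natrD, natrM).
rewrite nth_nil; ring.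
Qed.

Unset Implicit Arguments.

Theorem theorem5p2 (S : seq (blocks 4))
    (hS : S = [:: P1; P2; P4; P5] \/ S = [:: P1; P3; P4; P5]) :
  (fun n : nat => #|stoimenow_avoiding n S|%:R : rat) =1
  fps_div
    (fps_poly (1 - 4 *: 'X + 6 *: 'X^2 - 3 *: 'X^3 - 'X^4 : {poly rat}))
    (fps_poly ((1 - 'X) ^+ 3 * (1 - 2 *: 'X) : {poly rat})).
Proof.
move=> n; rewrite -avoiding_count_fps; congr _%:R.
case: n => [|k]; first exact: card_avoiding_0.
by case: hS => ->; [apply: card_avoiding_P1245|apply: card_avoiding_P1345].
Qed.
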